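(* Let $A\in\mathbb{H}^n_{++}$ and $C\subseteq\mathbb{H}^n_{++}$, and consider the two following optimisation problems: $$S_1 = \arg\min_{P\in C}\ \mathcal{D}_{\mathrm{LD}}(A,P), \qquad S_2 = \arg\min_{P\in C}\ \ln K(P^{-1}A).$$ If $C$ is a cone, then the following statements hold. (i) $\min_{P\in C}\mathcal{D}_{\mathrm{LD}}(A,P) = \min_{P\in C}\ln K(P^{-1}A)$; (ii) $S_1\subset S_2$; (iii) $\operatorname{cone}(S_1) = S_2$, where $\operatorname{cone}(S_1)$ denotes the conic hull of $S_1$.
   Context: $\mathbb{H}^n_{++}$ denotes the cone of $n\times n$ Hermitian positive definite matrices. A set $C\subseteq\mathbb{H}^n_{++}$ is a cone if $cP\in C$ for all $P\in C$ and all $c>0$. The conic hull of a set $S$ is the set of all finite linear combinations of elements of $S$ with nonnegative coefficients. For $A,P\in\mathbb{H}^n_{++}$ the Bregman log determinant divergence is $$\mathcal{D}_{\mathrm{LD}}(A,P) = \operatorname{tr}(AP^{-1}) - \ln\det(AP^{-1}) - n.$$ For an $n\times n$ matrix $M$ with positive real eigenvalues (such as $M=P^{-1}A$), Kaporin's condition number is $$K(M) = \left(\frac{\frac1n\operatorname{tr}(M)}{\det(M)^{1/n}}\right)^{n}.$$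
   Formalization: (iii) fails as printed: the conic hull contains 0 and C need not be convex. Proved instead: the set of positive multiples of S1 (smallest cone containing it) equals S2; S2 lies in the conic hull of S1; and the hull without 0 equals S2 if S2 is closed under addition. *)

(* Defs.v *)
From mathcomp Require Import all_boot all_order all_algebra.
From mathcomp Require Import sesquilinear spectral complex.
From mathcomp Require Import all_classical all_reals all_analysis.

Set Implicit Arguments.
Unset Strict Implicit.
Unset Printing Implicit Defensive.

Import Order.TTheory GRing.Theory Num.Theory.

Local Open Scope classical_set_scope.
Local Open Scope ring_scope.
Local Open Scope complex_scope.
Local Open Scope sesquilinear_scope.

Section LogDet.
Variables (R : realType) (n : nat).
Implicit Types (A P M : 'M[R[i]]_n) (S C : set 'M[R[i]]_n).

(* In the order of R[i], 0 < z means that z is real and positive. *)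
Definition hpd : set 'M[R[i]]_n :=
  [set P | P \is hermsymmx /\
     forall x : 'cV[R[i]]_n, x != 0 -> 0 < (x ^t* *m P *m x) 0 0].

(* For A and P in hpd, A *m invmx P and invmx P *m A are similar to Hermitian
   positive definite matrices, so their traces and determinants are real and
   positive; complex.Re then only changes their type from R[i] to R. *)
Definition logdet_div A P : R :=
  let M := A *m invmx P in
  complex.Re (\tr M) - ln (complex.Re (\det M)) - n%:R.

Definition kaporin M : R :=
  (n%:R^-1 * complex.Re (\tr M) / complex.Re (\det M) `^ n%:R^-1) ^+ n.

Definition is_cone C : Prop :=
  forall (c : R) P, 0 < c -> C P -> C (c%:C *: P).

(* Hull with respect to is_cone: the matrices c%:C *: P with 0 < c and S P. *)
Definition cone_hull S : set 'M[R[i]]_n := smallest is_cone S.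

(* Finite linear combinations with nonnegative coefficients. Unlike cone_hull,
   this set always contains 0 and is closed under addition. *)
Definition conic_hull S : set 'M[R[i]]_n :=
  [set X | exists (m : nat) (c : 'I_m -> R) (P : 'I_m -> 'M[R[i]]_n),
     (forall i, 0 <= c i /\ S (P i)) /\ X = \sum_(i < m) (c i)%:C *: P i].

End LogDet.

Section Minimisation.
Variables (T : Type) (R : realType).

Definition argmin (f : T -> R) (C : set T) : set T :=
  [set x | C x /\ forall y, C y -> f x <= f y].

(* The minimum of f over C exists and equals m. *)
Definition is_min (f : T -> R) (C : set T) (m : R) : Prop :=
  (f @` C) m /\ lbound (f @` C) m.

End Minimisation.

(* Main.v *)
Require Import Defs.
From mathcomp Require Import all_boot all_order all_algebra.
From mathcomp Require Import sesquilinear spectral complex.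
From mathcomp Require Import all_classical all_reals all_analysis.
From mathcomp Require Import ring.

Import Order.TTheory GRing.Theory Num.Theory.

Local Open Scope classical_set_scope.
Local Open Scope ring_scope.
Local Open Scope complex_scope.

(** For P in C let M = A P^-1 have trace t > 0 and determinant d > 0. Then
      D(P) = t - ln d - n   and   L(P) = n ln (t / n) - ln d,
    so D(P) - L(P) = n (t / n - 1 - ln (t / n)) >= 0 because ln x <= x - 1,
    with equality as soon as t = n ([logdet_div_kaporin]).  L does not change
    when P is multiplied by a positive scalar, whereas t is divided by that
    scalar.  Hence every P in the cone C has the rescaled version
    P' = (t / n) P in C, for which
      D(P') = L(P') = L(P).
    The facts L <= D and D(P') = L(P) alone imply that the two minima agree,
    that minimisers of D minimise L, and that rescaling maps minimisers of L to
    minimisers of D ([is_min_rescale], [argmin_rescale_sub], [argmin_rescale]).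
    The identity P = (n / t) P' and the scale invariance of L then show that
    the minimisers of L are the positive multiples of those of D.  A sum of
    several such multiples need not lie in C, let alone minimise L; if the set
    of minimisers of L is closed under addition, then every nonzero nonnegative
    combination is again in it.

    What remains is that t and d are positive.  This comes from the spectral
    decomposition A = U^* diag(a) U with positive a: the determinant of A is
    the product of the a_i, and t is the sum of the a_i times the diagonal
    entries of U P^-1 U^*, which are values of the positive form of P^-1
    ([hpd_det_gt0], [hpd_tr_gt0]). *)

(** * Minimisation in the presence of a rescaling map *)

Section Rescaling.
Variables (T : Type) (R : realType) (f g : T -> R) (C : set T) (s : T -> T).
Hypothesis sC : forall x, C x -> C (s x).
Hypothesis le_gf : forall x, C x -> g x <= f x.
Hypothesis f_s : forall x, C x -> f (s x) = g x.

(** At a minimiser x of f the chain f x <= f (s x) = g x <= f x collapses. *)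
Lemma argmin_rescale_eq x : argmin f C x -> f x = g x.
Proof.
move=> [Cx xmin]; apply/le_anti; rewrite le_gf // andbT.
by rewrite -(f_s _ Cx); exact/xmin/sC.
Qed.

Lemma argmin_rescale_sub : argmin f C `<=` argmin g C.
Proof.
move=> x xmin; split=> [|y Cy]; first by case: xmin.
rewrite -argmin_rescale_eq // -(f_s _ Cy).
by case: xmin => _; apply; exact: sC.
Qed.

Lemma argmin_rescale x : argmin g C x -> argmin f C (s x).
Proof.
move=> [Cx xmin]; split=> [|y Cy]; first exact: sC.
by rewrite f_s //; exact: le_trans (xmin _ Cy) (le_gf _ Cy).
Qed.

Lemma is_minP (h : T -> R) m :
  is_min h C m <-> exists2 x, argmin h C x & h x = m.
Proof.
split=> [[[x Cx <-] lb]|[x [Cx xmin] <-]].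
  by exists x => //; split=> // y Cy; apply: lb; exists y.
by split; [exists x | move=> _ [y Cy <-]; exact: xmin].
Qed.

Lemma is_min_rescale m : is_min f C m <-> is_min g C m.
Proof.
rewrite !is_minP; split=> -[x xmin <-].
  by exists x; [exact: argmin_rescale_sub | rewrite argmin_rescale_eq].
by exists (s x); [exact: argmin_rescale | rewrite f_s //; case: xmin].
Qed.

End Rescaling.

(** * Hermitian positive definite matrices *)

Section PositiveDefinite.
Local Open Scope sesquilinear_scope.
Variables (R : realType) (n : nat).
Implicit Types A P U : 'M[R[i]]_n.

(** The diagonal entry is the value of the form of P at the vector U^* e_k,
    which is not 0 because U^* is injective. *)
Lemma congr_diag_gt0 P U (k : 'I_n) : U \is unitarymx ->
  (forall x : 'cV[R[i]]_n, x != 0 -> 0 < (x ^t* *m P *m x) 0 0) ->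
  0 < (U *m P *m U ^t*) k k.
Proof.
move=> uU Ppos; pose x : 'cV[R[i]]_n := U ^t* *m delta_mx k 0.
have Ux : U *m x = delta_mx k 0.
  by rewrite mulmxA (unitarymxP uU) mul1mx.
have xN0 : x != 0.
  apply/eqP => x0; move/matrixP/(_ k 0): Ux; rewrite x0 mulmx0 !mxE !eqxx.
  by move/esym/eqP; rewrite oner_eq0.
have -> : (U *m P *m U ^t*) k k = (x ^t* *m P *m x) 0 0; last exact: Ppos.
rewrite /x trmx_mul map_mxM trmxCK trmx_delta map_delta_mx !mulmxA.
by rewrite -colE [RHS]mxE -!mulmxA -rowE [RHS]mxE.
Qed.

(** The eigenvalues are the diagonal entries of U P U^*. *)
Lemma hpd_spectral P : hpd P -> exists (U : 'M[R[i]]_n) (d : 'rV[R[i]]_n),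
  [/\ U \is unitarymx, forall k, 0 < d 0 k & P = U ^t* *m diag_mx d *m U].
Proof.
move=> [Pherm Ppos]; have uU := spectral_unitarymx P.
have /hermitian_normalmx /orthomx_spectralP PE := Pherm.
rewrite invmx_unitary // in PE.
exists (spectralmx P), (spectral_diag P); split=> // k.
have := congr_diag_gt0 P _ k uU Ppos.
by rewrite {2}PE !mulmxA (unitarymxP uU) mul1mx mulmxtVK // !mxE eqxx mulr1n.
Qed.

Lemma hpd_det_gt0 P : hpd P -> 0 < \det P.
Proof.
move=> /hpd_spectral[U [d [uU d_gt0 ->]]].
rewrite !det_mulmx mulrAC -det_mulmx -invmx_unitary //.
by rewrite mulVmx ?unitarymx_unit // det1 mul1r det_diag prodr_gt0.
Qed.

Lemma hpd_unitmx P : hpd P -> P \in unitmx.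
Proof. by move=> /hpd_det_gt0 P_gt0; rewrite unitmxE unitfE gt_eqF. Qed.

(** The form of P^-1 at x is the form of P at P^-1 x. *)
Lemma hpd_inv_form_gt0 P : hpd P ->
  forall x : 'cV[R[i]]_n, x != 0 -> 0 < (x ^t* *m invmx P *m x) 0 0.
Proof.
move=> hP x x_neq0; have uP := hpd_unitmx _ hP; case: hP => Pherm Ppos.
have P_adj : P ^t* = P.
  by have /is_hermitianmxP := Pherm; rewrite expr0 scale1r => <-.
pose y := invmx P *m x; have xE : x = P *m y by rewrite mulKVmx.
have -> : x ^t* *m invmx P *m x = y ^t* *m P *m y.
  by rewrite -[_ *m x]mulmxA -/y {1}xE trmx_mul map_mxM P_adj.
by apply: Ppos; apply: contraNneq x_neq0; rewrite xE => ->; rewrite mulmx0.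
Qed.

Lemma hpd_tr_gt0 A P : (0 < n)%N -> hpd A -> hpd P ->
  0 < \tr (A *m invmx P).
Proof.
move=> n_gt0 /hpd_spectral[U [d [uU d_gt0 ->]]] hP.
rewrite -!mulmxA mxtrace_mulC -!mulmxA; set Q := U *m _.
have trE : \tr (diag_mx d *m Q) = \sum_k d 0 k * Q k k.
  by apply: eq_bigr => k _; rewrite mul_diag_mx mxE.
have term_gt0 k : 0 < d 0 k * Q k k.
  rewrite mulr_gt0 // /Q mulmxA; apply: congr_diag_gt0 => //.
  exact: hpd_inv_form_gt0.
rewrite trE (bigD1 (Ordinal n_gt0)) //= ltr_wpDr //.
by apply: sumr_ge0 => k _; exact: ltW.
Qed.

Lemma hpd_det_mul_inv_gt0 A P : hpd A -> hpd P -> 0 < \det (A *m invmx P).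
Proof.
by move=> hA hP; rewrite det_mulmx det_inv mulr_gt0 ?invr_gt0 ?hpd_det_gt0.
Qed.

Lemma hpd_neq0 P : (0 < n)%N -> hpd P -> P != 0.
Proof.
move=> n_gt0 hP; apply/eqP => P0; have := hpd_det_gt0 _ hP.
by rewrite P0 -[X in \det X](scale0r 0) detZ expr0n eqn0Ngt n_gt0 mul0r ltxx.
Qed.

End PositiveDefinite.

(** * The divergence and the logarithm of the condition number *)

Section DivergenceKaporin.
Variables (R : realType) (n : nat).
Hypothesis n_gt0 : (0 < n)%N.
Implicit Types A P M N : 'M[R[i]]_n.

Lemma ReZ (c : R) (z : R[i]) : complex.Re (c%:C * z) = c * complex.Re z.
Proof. by case: z => a b /=; rewrite mul0r subr0. Qed.

Lemma Re_gt0 (z : R[i]) : 0 < z -> 0 < complex.Re z.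
Proof. by rewrite ltcE => /andP[]. Qed.

Lemma real_complexX (c : R) k : (c ^+ k)%:C = c%:C ^+ k.
Proof. exact: rmorphXn. Qed.

(** The divergence is stated with A P^-1 and the condition number with P^-1 A;
    trace and determinant do not see the difference. *)
Lemma kaporin_mulC M N : kaporin (M *m N) = kaporin (N *m M).
Proof. by rewrite /kaporin mxtrace_mulC !det_mulmx [_ * \det N]mulrC. Qed.

Lemma ln_kaporinE M : 0 < complex.Re (\tr M) -> 0 < complex.Re (\det M) ->
  ln (kaporin M) =
    n%:R * ln (complex.Re (\tr M) / n%:R) - ln (complex.Re (\det M)).
Proof.
rewrite /kaporin; move: (complex.Re (\tr M)) (complex.Re (\det M)).
move=> t d t_gt0 d_gt0.
have nR_gt0 : 0 < n%:R :> R by rewrite ltr0n.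
have mean_gt0 : 0 < t / n%:R by rewrite divr_gt0.
have root_gt0 : 0 < d `^ n%:R^-1 by exact: powR_gt0.
rewrite [n%:R^-1 * t]mulrC lnXn ?divr_gt0 // ln_div ?posrE // ln_powR.
by rewrite -[(_ - _) *+ n]mulr_natl mulrBr mulVKf // gt_eqF.
Qed.

(** The factor c enters n ln (t / n) and ln d as the same summand n ln c. *)
Lemma ln_kaporinZ (c : R) M : 0 < c ->
  0 < complex.Re (\tr M) -> 0 < complex.Re (\det M) ->
  ln (kaporin (c%:C *: M)) = ln (kaporin M).
Proof.
move=> c_gt0 t_gt0 d_gt0; have cn_gt0 : 0 < c ^+ n by exact: exprn_gt0.
have nR_gt0 : 0 < n%:R :> R by rewrite ltr0n.
have trE : complex.Re (\tr (c%:C *: M)) = c * complex.Re (\tr M).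
  by rewrite mxtraceZ ReZ.
have detE : complex.Re (\det (c%:C *: M)) = c ^+ n * complex.Re (\det M).
  by rewrite detZ -real_complexX ReZ.
rewrite !ln_kaporinE ?trE ?detE ?mulr_gt0 // -mulrA.
rewrite !lnM ?posrE ?divr_gt0 ?mulr_gt0 ?invr_gt0 //.
rewrite lnXn // -[ln c *+ n]mulr_natl.
ring.
Qed.

Lemma ln_le_sub1 (x : R) : 0 < x -> ln x <= x - 1.
Proof.
by move=> x_gt0; rewrite -[x in ln x](subrKC 1) le_ln1Dx // ltrBDl addrN.
Qed.

Variable A : 'M[R[i]]_n.
Hypothesis A_hpd : hpd A.

Definition mean_eigenvalue P : R := complex.Re (\tr (A *m invmx P)) / n%:R.

Lemma mean_eigenvalue_gt0 P : hpd P -> 0 < mean_eigenvalue P.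
Proof.
move=> hP; rewrite divr_gt0 ?ltr0n //; apply: Re_gt0; exact: hpd_tr_gt0.
Qed.

(** The trace is n times the mean eigenvalue, so the terms in the determinant
    cancel and only the gap in ln x <= x - 1 at the mean eigenvalue is left. *)
Lemma logdet_div_kaporin P : hpd P ->
  logdet_div A P = ln (kaporin (invmx P *m A)) +
    n%:R * (mean_eigenvalue P - 1 - ln (mean_eigenvalue P)).
Proof.
move=> hP; rewrite kaporin_mulC ln_kaporinE; first last.
- exact/Re_gt0/hpd_det_mul_inv_gt0.
- exact/Re_gt0/hpd_tr_gt0.
have nR_neq0 : n%:R != 0 :> R by rewrite pnatr_eq0 -lt0n.
rewrite /logdet_div -/(mean_eigenvalue P).
have -> : complex.Re (\tr (A *m invmx P)) = n%:R * mean_eigenvalue P.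
  by rewrite mulrC divfK.
ring.
Qed.

Lemma ln_kaporin_le P : hpd P -> ln (kaporin (invmx P *m A)) <= logdet_div A P.
Proof.
move=> hP; rewrite logdet_div_kaporin // lerDl mulr_ge0 // subr_ge0.
exact/ln_le_sub1/mean_eigenvalue_gt0.
Qed.

Lemma hpd_invmxZ (c : R) P : 0 < c -> hpd P ->
  invmx (c%:C *: P) = (c^-1)%:C *: invmx P.
Proof.
move=> c_gt0 hP.
have c_unit : c%:C \is a GRing.unit.
  by rewrite unitfE -(rmorph0 (real_complex R)) (inj_eq (@complexI _)) gt_eqF.
rewrite invmxZ; first by rewrite -[(c^-1)%:C]/(real_complex R c^-1) fmorphV.
by rewrite unitmxZ ?hpd_unitmx.
Qed.

Lemma ln_kaporin_scale (c : R) P : 0 < c -> hpd P ->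
  ln (kaporin (invmx (c%:C *: P) *m A)) = ln (kaporin (invmx P *m A)).
Proof.
move=> c_gt0 hP; rewrite [in LHS]kaporin_mulC [in RHS]kaporin_mulC.
rewrite (hpd_invmxZ _ _ c_gt0 hP) -scalemxAr; apply: ln_kaporinZ.
- by rewrite invr_gt0.
- exact/Re_gt0/hpd_tr_gt0.
- exact/Re_gt0/hpd_det_mul_inv_gt0.
Qed.

Definition normalize P : 'M[R[i]]_n := (mean_eigenvalue P)%:C *: P.

Lemma mean_eigenvalue_normalize P : hpd P -> mean_eigenvalue (normalize P) = 1.
Proof.
move=> hP; have m_gt0 := mean_eigenvalue_gt0 _ hP.
rewrite {1}/mean_eigenvalue hpd_invmxZ // -scalemxAr mxtraceZ ReZ -mulrA.
by rewrite -/(mean_eigenvalue P) mulVf // gt_eqF.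
Qed.

(** Normalisation makes the trace of A P^-1 equal to n, where the tangent
    inequality ln x <= x - 1 is an equality. *)
Lemma logdet_div_normalize P : hpd P -> hpd (normalize P) ->
  logdet_div A (normalize P) = ln (kaporin (invmx P *m A)).
Proof.
move=> hP hP'; rewrite logdet_div_kaporin // mean_eigenvalue_normalize //.
rewrite ln1 subrr subr0 mulr0 addr0; apply: ln_kaporin_scale => //.
exact: mean_eigenvalue_gt0.
Qed.

Lemma normalizeK P : hpd P ->
  ((mean_eigenvalue P)^-1)%:C *: normalize P = P.
Proof.
move=> hP; rewrite scalerA -(rmorphM (real_complex R)) mulVf ?scale1r //.
by rewrite gt_eqF ?mean_eigenvalue_gt0.
Qed.

End DivergenceKaporin.

Arguments mean_eigenvalue {R n} A P.
Arguments normalize {R n} A P.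

(** * Conic hulls *)

Section ConicHull.
Variables (R : realType) (n : nat).
Implicit Types S K : set 'M[R[i]]_n.

(** Terms with coefficient 0 are dropped; the others lie in the cone K. *)
Lemma conic_hull_sub K S : is_cone K ->
  (forall P Q, K P -> K Q -> K (P + Q)) ->
  S `<=` K -> conic_hull S `\ 0 `<=` K.
Proof.
move=> K_cone K_add SK _ [[m [c [P [cP ->]]]]].
set X := \sum_(i < m) _ => X_neq0.
suff [] : X = 0 \/ K X by [].
apply: (big_ind (fun Y => Y = 0 \/ K Y)) => [|Y Z [->|KY] [->|KZ]|i _].
- by left.
- by left; rewrite addr0.
- by right; rewrite add0r.
- by right; rewrite addr0.
- by right; exact: K_add.
have [ci_ge0 SPi] := cP i; have [ci_gt0|ci_le0] := ltP 0 (c i).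
  by right; apply: K_cone => //; exact: SK.
have -> : c i = 0 by apply/le_anti; rewrite ci_le0.
by left; rewrite scale0r.
Qed.

Lemma conic_hull_scale S (c : R) P : 0 <= c -> S P -> conic_hull S (c%:C *: P).
Proof.
by move=> c_ge0 SP; exists 1%N, (fun=> c), (fun=> P); rewrite big_ord1.
Qed.

Lemma cone_hull_scale S (c : R) P : 0 < c -> S P -> cone_hull S (c%:C *: P).
Proof. by move=> c_gt0 SP K [K_cone SK]; apply: K_cone => //; exact: SK. Qed.

End ConicHull.

Theorem proposition1 (R : realType) (n : nat) (n_gt0 : (0 < n)%N)
    (A : 'M[R[i]]_n) (C : set 'M[R[i]]_n)
    (A_hpd : hpd A) (C_hpd : C `<=` @hpd R n) (C_cone : is_cone C) :
  let D := fun P : 'M[R[i]]_n => logdet_div A P in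
  let L := fun P : 'M[R[i]]_n => ln (kaporin (invmx P *m A)) in
  let S1 := argmin D C in
  let S2 := argmin L C in
  [/\ forall m : R, is_min D C m <-> is_min L C m,
      S1 `<=` S2
    & [/\ cone_hull S1 = S2,
          S2 `<=` conic_hull S1
        & (forall P Q : 'M[R[i]]_n, S2 P -> S2 Q -> S2 (P + Q)) ->
          conic_hull S1 `\ 0 = S2]].
Proof.
move=> D L S1 S2; pose s := normalize A.
have mean_gt0 P : C P -> 0 < mean_eigenvalue A P.
  by move=> /C_hpd; exact: mean_eigenvalue_gt0.
have sC P : C P -> C (s P) by move=> CP; apply: C_cone => //; exact: mean_gt0.
have LD P : C P -> L P <= D P by move=> /C_hpd; exact: ln_kaporin_le.
have L_scale c P : 0 < c -> C P -> L (c%:C *: P) = L P.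
  by move=> c_gt0 /C_hpd; exact: ln_kaporin_scale.
have Ds P : C P -> D (s P) = L P.
  move=> CP; apply: (logdet_div_normalize _ _ n_gt0 _ A_hpd).
  - exact: C_hpd.
  - exact/C_hpd/sC.
have S12 : S1 `<=` S2 by exact: argmin_rescale_sub sC LD Ds.
have S2_cone : is_cone S2.
  move=> c P c_gt0 [CP Pmin]; split=> [|Q CQ]; first exact: C_cone.
  by rewrite (L_scale _ _ c_gt0 CP); exact: Pmin.
have S2_ray P : S2 P -> exists (c : R) (Q : 'M[R[i]]_n),
    [/\ 0 < c, S1 Q & P = c%:C *: Q].
  move=> S2P; have CP : C P by case: S2P.
  exists (mean_eigenvalue A P)^-1, (s P); split.
  - by rewrite invr_gt0; exact: mean_gt0.
  - exact: argmin_rescale sC LD Ds _ S2P.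
  - by rewrite (normalizeK _ _ n_gt0 _ A_hpd _ (C_hpd _ CP)).
have S2_conic : S2 `<=` conic_hull S1.
  move=> P /S2_ray[c [Q [c_gt0 S1Q ->]]].
  exact: conic_hull_scale (ltW c_gt0) S1Q.
split=> //; first by move=> m; exact: is_min_rescale sC LD Ds m.
split=> // [|S2_add]; apply/seteqP; split.
- exact: smallest_sub.
- by move=> P /S2_ray[c [Q [c_gt0 S1Q ->]]]; exact: cone_hull_scale.
- exact: conic_hull_sub.
- move=> P S2P; split; first exact: S2_conic.
  by apply/eqP/(hpd_neq0 _ _ _ n_gt0)/C_hpd; case: S2P.
Qed.
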